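(* Let $N\ge 1$, let $\mathbf{x}_1,\dots,\mathbf{x}_N\in\mathbb{R}^n$, let $\varepsilon>0$ and let $\phi:[0,\infty)\to\mathbb{R}$ be such that the $N\times N$ real matrix $\mathbf{A}$ with entries $\mathbf{A}(i,j)=\phi(\varepsilon\|\mathbf{x}_i-\mathbf{x}_j\|)$ is symmetric and positive definite. Let $k\in\{1,\dots,N\}$, let $j_1,\dots,j_k\in\{1,\dots,N\}$ be column indices and let $\lambda_1,\dots,\lambda_k$ be nonzero real numbers. Let $\mathbf{B}$ be an $N\times N$ matrix such that, for every $m=1,\dots,k$, $$\mathbf{B}(i,j_m)=0 \ \text{ for all } i\neq j_m,\qquad \mathbf{B}(j_m,j_m)=\lambda_m,$$ and $\mathbf{B}(:,j)=\mathbf{A}(:,j)$ for every $j\in\{1,\dots,N\}\setminus\{j_1,\dots,j_k\}$. Then the determinant of $\mathbf{B}$ is different from zero, i.e. $|\mathbf{B}|\neq 0$.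
   Context: $\|\cdot\|$ is the Euclidean norm on $\mathbb{R}^n$. $\mathbf{A}(:,j)$ denotes the $j$-th column of a matrix $\mathbf{A}$, $\mathbf{A}(i,j)$ its $(i,j)$ entry, and $|\mathbf{B}|$ the determinant of $\mathbf{B}$. Positive definite means $\mathbf{v}^T\mathbf{A}\mathbf{v}>0$ for all nonzero $\mathbf{v}\in\mathbb{R}^N$. *)

(* Defs.v *)
From mathcomp Require Import all_boot all_order all_algebra.
From mathcomp Require Import reals.

Set Implicit Arguments.
Unset Strict Implicit.
Unset Printing Implicit Defensive.

Import Order.TTheory GRing.Theory Num.Theory.
Local Open Scope ring_scope.

(* MathComp-Analysis equips 'cV[R]_n with the sup norm under the notation `|v|,
   so the Euclidean norm needs its own definition. *)
Definition enorm (R : realType) (n : nat) (v : 'cV[R]_n) : R :=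
  Num.sqrt (\sum_(i < n) v i ord0 ^+ 2).

(* The 1 x 1 matrix v^T A v is read as the scalar it contains. *)
Definition positive_definite (R : realType) (N : nat) (A : 'M[R]_N) : Prop :=
  forall v : 'cV[R]_N, v != 0 -> 0 < (v^T *m A *m v) ord0 ord0.

(* Main.v *)
(** If [B v = 0], let [w] be [v] with the coordinates in the replaced columns
    set to zero. Outside the replaced indices the rows of [B v = 0] read
    [(A w)_i = 0], so [w^T A w = 0] and [w = 0] by positive definiteness. The
    remaining rows then say [lambda_m v_(j_m) = 0], whence [v = 0]. *)
Require Import Defs.
From mathcomp Require Import all_boot all_order all_algebra.
From mathcomp Require Import reals.

Set Implicit Arguments.
Unset Strict Implicit.
Unset Printing Implicit Defensive.

Import Order.TTheory GRing.Theory Num.Theory.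
Local Open Scope ring_scope.

Theorem proposition3p2 (R : realType) (N n : nat) (hN : (1 <= N)%N)
  (x : 'I_N -> 'cV[R]_n) (eps : R) (heps : 0 < eps)
  (phi : R -> R) (* only its values on [0, +oo) are used *)
  (A : 'M[R]_N)
  (hA : forall i j, A i j = phi (eps * enorm (x i - x j)))
  (hAsym : A \is symmetricmx)
  (hApos : positive_definite A)
  (k : nat) (hk : (1 <= k <= N)%N)
  (j : 'I_k -> 'I_N)
  (lambda : 'I_k -> R) (hlambda : forall m, lambda m != 0)
  (B : 'M[R]_N)
  (hBoff : forall (m : 'I_k) (i : 'I_N), i != j m -> B i (j m) = 0)
  (hBdiag : forall m : 'I_k, B (j m) (j m) = lambda m)
  (hBcol : forall l : 'I_N, (forall m : 'I_k, l != j m) -> col l B = col l A) :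
  \det B != 0.
Proof.
(* [det0P] gives a left kernel vector; transposing first makes [u], read as a column, a kernel
   vector of [B]. *)
rewrite -det_tr; apply/negP => /det0P[u u0 uB].
have Bu i : \sum_l B i l * u 0 l = 0.
  have := congr1 (fun M : 'rV[R]_N => M 0 i) uB; rewrite !mxE => uBi.
  by rewrite -[RHS]uBi; apply: eq_bigr => l _; rewrite mxE mulrC.
pose w : 'cV[R]_N := \col_l (if l \in codom j then 0 else u 0 l).
have BA i l : l \notin codom j -> B i l = A i l.
  move=> lj; have /hBcol/colP/(_ i) : forall m, l != j m.
    by move=> m; apply: contraNneq lj => ->; apply: codom_f.
  by rewrite !mxE.
have Aw i : i \notin codom j -> (A *m w) i 0 = 0.
  move=> ij; rewrite mxE -[RHS](Bu i); apply: eq_bigr => l _; rewrite mxE.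
  (* In a replaced column both terms vanish: [w] is zero there, and [B i l] is off-diagonal since
     [i] is not a replaced index. *)
  case: ifPn => [/codomP[m lE]|lj]; last by rewrite BA.
  rewrite mulr0 lE hBoff ?mul0r //.
  by apply: contraNneq ij => ->; apply: codom_f.
have w0 : w = 0.
  apply/eqP; apply: contraT => /hApos; rewrite -mulmxA mxE big1 ?ltxx // => i _.
  rewrite !mxE; case: ifPn => [_|/Aw]; first by rewrite mul0r.
  by rewrite mxE => ->; rewrite mulr0.
have uN l : l \notin codom j -> u 0 l = 0.
  by move=> lj; have /colP/(_ l) := w0; rewrite !mxE (negbTE lj).
case/eqP: u0; apply/rowP => l; rewrite mxE.
have [/codomP[m ->]|/uN//] := boolP (l \in codom j).
(* In row [j m] only the diagonal term survives: [B] vanishes in the other replaced columns, [u] in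
   the rest. *)
have := Bu (j m); rewrite (bigD1 (j m)) //= big1 => [|i ijm].
  by rewrite addr0 hBdiag => /eqP; rewrite mulf_eq0 (negbTE (hlambda m)) => /eqP.
have [/codomP[p iE]|/uN->] := boolP (i \in codom j); last by rewrite mulr0.
by rewrite iE hBoff ?mul0r // -iE eq_sym.
Qed.
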